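(* There is no boolean query of (Extended Regular) XPath over $2$-data trees which is true in exactly those $2$-data trees $(t,d_1,d_2)$ that satisfy the property $$\psi=\forall x\,\forall y\quad d_1(x)=d_1(y)\iff d_2(x)=d_2(y).$$
   Context: Trees are finite, unranked, sibling-ordered, with nodes labeled by a finite nonempty alphabet (words are the special case of trees where each node has at most one child). Fix an infinite set of data values. A $2$-data tree $(t,d_1,d_2)$ consists of a tree $t$ over a finite alphabet and two functions $d_1,d_2$ from the nodes of $t$ to data values. Extended Regular XPath (called XPath for short) over $2$-data trees is defined inductively. (i) Let $\Gamma$ be a finite set of already defined unary XPath queries (empty in the induction base), and let $\varphi[x_1,\dots,x_m]$ be a formula of monadic second-order logic (with quantification over nodes and sets of nodes) that uses the queries of $\Gamma$ as unary predicates, unary predicates for the letters of the alphabet, and the binary child and next-sibling predicates, but makes no reference to data values other than inside the queries of $\Gamma$. Then $\varphi$ is an $m$-ary XPath query (boolean if $m=0$). (ii) If $\varphi[x,y_1,y_2]$ is a ternary XPath query and $i,j\in\{1,2\}$, then $\exists y_1\exists y_2\ (d_i(y_1)=d_j(y_2)\wedge\varphi[x,y_1,y_2])$ and $\exists y_1\exists y_2\ (d_i(y_1)\neq d_j(y_2)\wedge\varphi[x,y_1,y_2])$ are unary XPath queries (with free variable $x$). *)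

(* Defs.v *)
From mathcomp Require Import all_boot.
From mathcomp Require Import classical_sets.

Set Implicit Arguments.
Unset Strict Implicit.
Unset Printing Implicit Defensive.

Inductive tree (Sigma : Type) : Type :=
  Tree of Sigma & seq (tree Sigma).

Section Nodes.
Variable Sigma : Type.
Implicit Types t : tree Sigma.

Definition root t : Sigma := let: Tree a _ := t in a.
Definition children t : seq (tree Sigma) := let: Tree _ s := t in s.

(* The subtree at an address p: [::] is the address of the root, and i :: q
   leads to the address q in the i-th subtree below the root (from 0). *)
Fixpoint subtree t (p : seq nat) : option (tree Sigma) :=
  if p is i :: q then
    if onth (children t) i is Some u then subtree u q else None
  else Some t.

Definition node t : Type := {p : seq nat | isSome (subtree t p)}.

Definition has_letter t (a : Sigma) (x : node t) : Prop :=
  omap root (subtree t (val x)) = Some a.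

Definition is_child t (x y : node t) : Prop :=
  exists i : nat, val y = rcons (val x) i.

Definition is_next_sibling t (x y : node t) : Prop :=
  exists (p : seq nat) (i : nat), val x = rcons p i /\ val y = rcons p i.+1.

End Nodes.

Record data_tree (Sigma D : Type) : Type := DataTree {
  shape : tree Sigma;
  d1 : node shape -> D;
  d2 : node shape -> D
}.

Variant attribute : Type := Attr1 | Attr2.

Definition value (Sigma D : Type) (T : data_tree Sigma D) (i : attribute) :
    node (shape T) -> D :=
  match i with Attr1 => @d1 _ _ T | Attr2 => @d2 _ _ T end.

(* Monadic second-order formulas with n free node variables and k free set
   variables, over the letters, the child and next-sibling relations and extra
   unary predicates named by U.  Variables are de Bruijn indices: a quantifier
   binds index 0 and shifts the free indices of its kind by one. *)
Inductive mso (Sigma U : Type) (n k : nat) : Type :=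
| MLetter of Sigma & 'I_n
| MPred of U & 'I_n
| MChild of 'I_n & 'I_n
| MNextSibling of 'I_n & 'I_n
| MEq of 'I_n & 'I_n
| MIn of 'I_n & 'I_k
| MNot of mso Sigma U n k
| MAnd of mso Sigma U n k & mso Sigma U n k
| MOr of mso Sigma U n k & mso Sigma U n k
| MExNode of mso Sigma U n.+1 k
| MAllNode of mso Sigma U n.+1 k
| MExSet of mso Sigma U n k.+1
| MAllSet of mso Sigma U n k.+1.

Section MsoSemantics.
Variables (Sigma U : Type) (t : tree Sigma) (I : U -> node t -> Prop).

Fixpoint mso_holds (n k : nat) (phi : mso Sigma U n k) :
    n.-tuple (node t) -> k.-tuple (set (node t)) -> Prop :=
  match phi with
  | MLetter a x => fun e _ => has_letter a (tnth e x)
  | MPred u x => fun e _ => I u (tnth e x)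
  | MChild x y => fun e _ => is_child (tnth e x) (tnth e y)
  | MNextSibling x y => fun e _ => is_next_sibling (tnth e x) (tnth e y)
  | MEq x y => fun e _ => tnth e x = tnth e y
  | MIn x X => fun e E => tnth E X (tnth e x)
  | MNot f => fun e E => ~ mso_holds f e E
  | MAnd f g => fun e E => mso_holds f e E /\ mso_holds g e E
  | MOr f g => fun e E => mso_holds f e E \/ mso_holds g e E
  | MExNode f => fun e E => exists x : node t, mso_holds f [tuple of x :: e] E
  | MAllNode f => fun e E => forall x : node t, mso_holds f [tuple of x :: e] E
  | MExSet f =>
      fun e E => exists X : set (node t), mso_holds f e [tuple of X :: E]
  | MAllSet f =>
      fun e E => forall X : set (node t), mso_holds f e [tuple of X :: E]
  end.

End MsoSemantics.

(* Unary queries.  The finite set of queries used by an MSO formula consists of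
   those occurring in it under MPred.  In QEq and QNeq the indices 0, 1, 2 of
   the formula stand for x, y1, y2. *)
Inductive unary_query (Sigma : Type) : Type :=
| QMso of mso Sigma (unary_query Sigma) 1 0
| QEq of attribute & attribute & mso Sigma (unary_query Sigma) 3 0
| QNeq of attribute & attribute & mso Sigma (unary_query Sigma) 3 0.

Definition query (Sigma : Type) (m : nat) : Type :=
  mso Sigma (unary_query Sigma) m 0.

Section QuerySemantics.
Variables (Sigma D : Type) (T : data_tree Sigma D).

Fixpoint unary_holds (q : unary_query Sigma) (x : node (shape T)) : Prop :=
  match q with
  | QMso phi => mso_holds unary_holds phi [tuple x] [tuple]
  | QEq i j phi =>
      exists y1 y2 : node (shape T), value i y1 = value j y2 /\
        mso_holds unary_holds phi [tuple x; y1; y2] [tuple]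
  | QNeq i j phi =>
      exists y1 y2 : node (shape T), value i y1 <> value j y2 /\
        mso_holds unary_holds phi [tuple x; y1; y2] [tuple]
  end.

Definition query_holds (m : nat) (phi : query Sigma m)
    (e : m.-tuple (node (shape T))) : Prop :=
  mso_holds unary_holds phi e [tuple].

Definition boolean_query_holds (phi : query Sigma 0) : Prop :=
  query_holds phi [tuple].

Definition psi : Prop :=
  forall x y : node (shape T), d1 x = d1 y <-> d2 x = d2 y.

End QuerySemantics.

(* Main.v *)
(** The extensions of the unary subqueries of a query determine its truth value,
    and on a tree with O(N) nodes they form one of 2^O(N) profiles, whereas
    there are at least N^N equivalence relations induced by data values.  So two
    distinct relations E and E' have the same profile when both attributes
    induce E and when both induce E'.  If the two attributes never share a
    value, a subquery compares data only within one attribute; hence the tree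
    where d1 induces E and d2 induces E' has the same profile again, although it
    violates psi. *)
Require Import Defs.
From mathcomp Require Import all_boot zify.
From mathcomp Require Import boolp classical_sets functions cardinality.

Set Implicit Arguments.
Unset Strict Implicit.
Unset Printing Implicit Defensive.

Local Open Scope classical_set_scope.

Section Subqueries.
Variables (Sigma U V : Type) (f : U -> seq V).

Fixpoint mso_flatten n k (phi : mso Sigma U n k) : seq V :=
  match phi with
  | MPred u _ => f u
  | MNot g | MExNode g | MAllNode g | MExSet g | MAllSet g => mso_flatten g
  | MAnd g h | MOr g h => mso_flatten g ++ mso_flatten h
  | _ => [::]
  end.

End Subqueries.

Fixpoint subqueries Sigma (u : unary_query Sigma) : seq (unary_query Sigma) :=
  u :: match u with
       | QMso phi => mso_flatten (@subqueries Sigma) phi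
       | QEq _ _ phi | QNeq _ _ phi => mso_flatten (@subqueries Sigma) phi
       end.

Fixpoint mso_all Sigma U (P : U -> Prop) n k (phi : mso Sigma U n k) : Prop :=
  match phi with
  | MPred u _ => P u
  | MNot g | MExNode g | MAllNode g | MExSet g | MAllSet g => mso_all P g
  | MAnd g h | MOr g h => mso_all P g /\ mso_all P h
  | _ => True
  end.

(* An explicit transparent term: the guard condition in unary_query_nested_ind
   has to see through it. *)
Lemma mso_allT Sigma U (P : U -> Prop) (HP : forall u, P u) :
  forall n k (phi : mso Sigma U n k), mso_all P phi.
Proof.
exact: (fix F n k (phi : mso Sigma U n k) : mso_all P phi :=
  match phi with
  | MPred u _ => HP u
  | MNot g => F _ _ g | MExNode g => F _ _ g | MAllNode g => F _ _ g
  | MExSet g => F _ _ g | MAllSet g => F _ _ g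
  | MAnd g h => conj (F _ _ g) (F _ _ h)
  | MOr g h => conj (F _ _ g) (F _ _ h)
  | MLetter _ _ => I | MChild _ _ => I | MNextSibling _ _ => I
  | MEq _ _ => I | MIn _ _ => I
  end).
Defined.

(** The generated induction principle gives no hypothesis for queries nested under [MPred];
    [mso_all] supplies it. *)
Lemma unary_query_nested_ind Sigma (P : unary_query Sigma -> Prop) :
  (forall phi, mso_all P phi -> P (QMso phi)) ->
  (forall i j phi, mso_all P phi -> P (QEq i j phi)) ->
  (forall i j phi, mso_all P phi -> P (QNeq i j phi)) ->
  forall u, P u.
Proof.
move=> Hm He Hn; fix F 1 => -[phi|i j phi|i j phi].
- exact: Hm (mso_allT F phi).
- exact: He (mso_allT F phi).
- exact: Hn (mso_allT F phi).
Qed.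

Lemma mso_all_mp Sigma U (P Q : U -> Prop) n k (phi : mso Sigma U n k) :
  mso_all (fun u => P u -> Q u) phi -> mso_all P phi -> mso_all Q phi.
Proof. by elim: phi => //= n' k' g IHg h IHh [/IHg Hg /IHh Hh] [/Hg ? /Hh ?]. Qed.

Lemma mso_all_flatten Sigma U V (f : U -> seq V) (P : V -> Prop)
    n k (phi : mso Sigma U n k) :
  (forall v, List.In v (mso_flatten f phi) -> P v) ->
  mso_all (fun u => forall v, List.In v (f u) -> P v) phi.
Proof.
elim: phi => //= n' k' g IHg h IHh H; split;
  by [apply: IHg => v Hv; apply/H/List.in_or_app; left
     |apply: IHh => v Hv; apply/H/List.in_or_app; right].
Qed.

Lemma eq_mso_holds Sigma U (t : tree Sigma) (I J : U -> node t -> Prop)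
    n k (phi : mso Sigma U n k) :
  mso_all (fun u => forall x, I u x <-> J u x) phi ->
  forall e E, mso_holds I phi e E <-> mso_holds J phi e E.
Proof.
elim: phi => //= n' k'.
- by move=> g IH /IH H e E; rewrite H.
- by move=> g IHg h IHh [/IHg Hg /IHh Hh] e E; rewrite Hg Hh.
- by move=> g IHg h IHh [/IHg Hg /IHh Hh] e E; rewrite Hg Hh.
- by move=> g IH /IH H e E; split=> -[x Hx]; exists x; apply/H.
- by move=> g IH /IH H e E; split=> Hx x; apply/H.
- by move=> g IH /IH H e E; split=> -[x Hx]; exists x; apply/H.
- by move=> g IH /IH H e E; split=> Hx x; apply/H.
Qed.

Section Mixing.
Variables (Sigma D : Type) (t : tree Sigma) (f f' g g' : node t -> D).
Hypotheses (fg : forall x y, f x <> g y) (fg' : forall x y, f x <> g' y).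

Let T := DataTree f g.
Let T' := DataTree f' g'.
Let M := DataTree f g'.

Let agree (v : unary_query Sigma) :=
  forall x : node t, @unary_holds _ _ T v x <-> @unary_holds _ _ T' v x.

Let mixes (v : unary_query Sigma) := forall x : node t,
  (@unary_holds _ _ M v x <-> @unary_holds _ _ T v x) /\
  (@unary_holds _ _ M v x <-> @unary_holds _ _ T' v x).

Lemma mso_holds_mix n k (phi : mso Sigma (unary_query Sigma) n k) :
  mso_all mixes phi -> forall e E,
  (mso_holds (@unary_holds _ _ M) phi e E <->
   mso_holds (@unary_holds _ _ T) phi e E) /\
  (mso_holds (@unary_holds _ _ M) phi e E <->
   mso_holds (@unary_holds _ _ T') phi e E).
Proof.
move=> H e E; split; apply: eq_mso_holds; apply: mso_all_mp H;
  by apply: mso_allT => v /[swap] x /(_ x) [].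
Qed.

(* As T and T' agree on v, the disjunction amounts to mixes: attribute 1 has the
   same values in M as in T, attribute 2 the same as in T'. *)
Let mixes1 (v : unary_query Sigma) (x : node t) :=
  (@unary_holds _ _ M v x <-> @unary_holds _ _ T v x) \/
  (@unary_holds _ _ M v x <-> @unary_holds _ _ T' v x).

Lemma unary_holds_mix u :
  (forall v, List.In v (subqueries u) -> agree v) -> mixes u.
Proof.
have eq_ex (P Q : node t -> node t -> Prop) :
    (forall y z, P y z <-> Q y z) ->
    (exists y z, P y z) <-> (exists y z, Q y z).
  by move=> PQ; split=> -[y [z /PQ ?]]; exists y, z.
have fgF x y : (f x = g y) <-> False by split=> // /fg.
have fg'F x y : (f x = g' y) <-> False by split=> // /fg'.
have gfF x y : (g x = f y) <-> False by split=> // /esym/fg.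
have g'fF x y : (g' x = f y) <-> False by split=> // /esym/fg'.
elim/unary_query_nested_ind: u => [phi|i j phi|i j phi] IH H x;
  have /= Hx := H _ (or_introl erefl) x;
  have {}IH := mso_holds_mix (mso_all_mp IH
    (mso_all_flatten (fun v Hv => H v (or_intror Hv)))).
- exact: IH.
- suff: mixes1 (QEq i j phi) x by rewrite /mixes1 /= in Hx *; tauto.
  (* [M] is compared with [T'] only when both attributes are 2. In the two mixed cases the equality
     fails in [M] and in [T] alike. *)
  case: i j {H Hx} => -[]; [left|left|left|right]; apply: eq_ex => y z /=.
  + by rewrite (IH _ _).1.
  + by rewrite fgF fg'F; tauto.
  + by rewrite gfF g'fF; tauto.
  + by rewrite (IH _ _).2.
- suff: mixes1 (QNeq i j phi) x by rewrite /mixes1 /= in Hx *; tauto.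
  case: i j {H Hx} => -[]; [left|left|left|right]; apply: eq_ex => y z /=.
  + by rewrite (IH _ _).1.
  (* The cross-attribute inequality always holds, so only the formula remains to be compared. *)
  + by rewrite fgF fg'F (IH _ _).1.
  + by rewrite gfF g'fF (IH _ _).1.
  + by rewrite (IH _ _).2.
Qed.

Lemma boolean_query_holds_mix q :
  (forall v, List.In v (mso_flatten (@subqueries Sigma) q) -> agree v) ->
  boolean_query_holds M q <-> boolean_query_holds T q.
Proof.
move=> /mso_all_flatten/(mso_all_mp (mso_allT unary_holds_mix q)).
by move=> /mso_holds_mix/(_ [tuple] [tuple])[].
Qed.

End Mixing.

Section Star.
Variables (Sigma : Type) (a : Sigma) (m : nat).

Definition star : tree Sigma := Tree a (nseq m (Tree a [::])).

Definition star_root : node star := exist _ [::] isT.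

Lemma star_childP (i : 'I_m) : isSome (subtree star [:: val i]).
Proof. by rewrite /= onth_nseq ltn_ord. Qed.

Definition star_child (i : 'I_m) : node star :=
  exist (fun p => isSome (subtree star p)) [:: val i] (star_childP i).

(** Indexing the nodes by a finite type makes the profiles countable as finite functions. *)
Definition star_node (o : option 'I_m) : node star := oapp star_child star_root o.

Lemma star_node_surj (x : node star) : exists o, x = star_node o.
Proof.
case: x => -[|i p] Hp; first by exists None; apply: val_inj.
have := Hp; rewrite /= onth_nseq; case: ltnP => // im.
case: p Hp => [|j p] Hp; last by rewrite /= onth0n.
by move=> _; exists (Some (Ordinal im)); apply: val_inj.
Qed.

Definition star_index (x : node star) : option 'I_m :=
  if val x is i :: _ then insub i else None.

Lemma star_nodeK : cancel star_node star_index.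
Proof. by case=> [i|] //; rewrite /star_index /= valK. Qed.

End Star.

(* The first N children realise all colours and the last N are coloured by s,
   so that s can be read off the kernel of the colouring. *)
Definition coloring Sigma (a : Sigma) N (s : {ffun 'I_N -> 'I_N})
    (x : node (star a (N + N))) : nat :=
  if star_index x is Some i then
    match fintype.split i with inl j => val j | inr j => val (s j) end
  else 0.

Lemma coloring_kernel_inj Sigma (a : Sigma) N (s s' : {ffun 'I_N -> 'I_N}) :
  (forall x y : node (star a (N + N)),
    coloring s x = coloring s y <-> coloring s' x = coloring s' y) -> s = s'.
Proof.
move=> H; apply/ffunP => j; apply/val_inj.
(* The second child has colour [s j] under both colourings; the first has colour [s j] under [s] and
   [s' j] under [s']. *)
have := H (star_node a (Some (rshift N j))) (star_node a (Some (lshift N (s j)))).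
rewrite /coloring !star_nodeK.
by rewrite (unsplitK (inr j)) (unsplitK (inl (s j))) => -[/(_ erefl)].
Qed.

(** The left side counts the profiles of [k] queries on a star with [N + N] leaves, the right side
    the maps [s]. *)
Lemma exp2_lt_selfexp k : exists N, 2 ^ ((N + N).+1 * k) < N ^ N.
Proof.
(* With [N = n.+1] the exponent is [(2n + 3)k <= 3k(n + 1)], so the left side is at most
   [n ^ N < N ^ N]. *)
exists (2 ^ (3 * k)).+1; set n := 2 ^ (3 * k).
apply: (@leq_ltn_trans (n ^ n.+1)); last by rewrite ltn_exp2r.
by rewrite -expnM leq_exp2l //; nia.
Qed.

Lemma In_tnth T (s : seq T) v :
  List.In v s -> exists i, tnth (in_tuple s) i = v.
Proof.
elim: s => //= x s IH [->|/IH[i <-]]; first by exists ord0.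
by exists (lift ord0 i); rewrite !(tnth_nth x).
Qed.

Lemma infinite_set_injection D :
  infinite_set [set: D] -> exists e : nat -> D, injective e.
Proof.
move=> /infiniteP/card_leP[f]; exists (fun n => val (f (to_setT n))) => m n.
by move=> /val_inj/(inj (in_setT _) (in_setT _)) [].
Qed.

Theorem theorem6 (Sigma : finType) (D : Type)
    (Sigma_nonempty : 0 < #|Sigma|) (D_infinite : infinite_set [set: D]) :
  ~ exists q : query Sigma 0,
      forall T : data_tree Sigma D, boolean_query_holds T q <-> psi T.
Proof.
case=> q Hq.
have /card_gt0P[a _] := Sigma_nonempty.
have [e e_inj] := infinite_set_injection D_infinite.
pose L := mso_flatten (@subqueries Sigma) q.
have [N HN] := exp2_lt_selfexp (size L).
(* Even codes for attribute 1 and odd codes for attribute 2 keep their values disjoint, whatever the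
   two colourings are. *)
pose f1 s x := e (coloring (a := a) (N := N) s x).*2.
pose f2 s x := e (coloring (a := a) (N := N) s x).*2.+1.
pose P s s' := DataTree (f1 s) (f2 s').
pose profile (s : {ffun 'I_N -> 'I_N}) :
    {ffun option 'I_(N + N) * 'I_(size L) -> bool} :=
  [ffun p => `[< @unary_holds _ _ (P s s) (tnth (in_tuple L) p.2)
                   (star_node a p.1) >]].
have [s [s' ss' Pss']] : exists s, exists2 s', s <> s' & profile s = profile s'.
  apply: contrapT => H.
  have /leq_card : injective profile.
    move=> s s' Hs; apply: contrapT => ss'; apply: H.
    by exists s, s'.
  by rewrite !card_ffun card_prod card_option !card_ord card_bool leqNgt HN.
have f12 r r' x y : f1 r x <> f2 r' y by move=> /e_inj; lia.
have agree v : List.In v L -> forall x,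
    @unary_holds _ _ (P s s) v x <-> @unary_holds _ _ (P s' s') v x.
  move=> Hv x; have [i <-] := In_tnth Hv.
  have [o ->] := star_node_surj x.
  have /ffunP/(_ (o, i)) := Pss'; rewrite !ffunE.
  exact: asbool_eq_equiv.
have qs := boolean_query_holds_mix (f12 s s) (f12 s s') agree.
(* [P s s] satisfies [psi], as both attributes recode one colouring injectively; [q] carries this
   over to [P s s']. *)
have : psi (P s s') by apply/Hq/qs/Hq => x y; split=> /e_inj H; congr e; lia.
(* On [P s s'], [psi] says that the colourings of [s] and [s'] have the same kernel, which forces
   [s = s']. *)
move=> H; apply/ss'/coloring_kernel_inj => x y; split=> E.
  have /H/e_inj : f1 s x = f1 s y by rewrite /f1 E.
  by case=> /double_inj.
have /H/e_inj : f2 s' x = f2 s' y by rewrite /f2 E.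
by move=> /double_inj.
Qed.
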